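(* Let $\mathbb{K}$ be a field of characteristic zero, let $n\ge 1$, and let $\sigma=(\sigma(x_1),\ldots,\sigma(x_n),\sigma(p_1),\ldots,\sigma(p_n))$ be a polynomial symplectomorphism of $\mathbb{K}[x_1,\ldots,x_n,p_1,\ldots,p_n]$ with unit Jacobian which is origin-preserving (all the polynomials $\sigma(x_i)$, $\sigma(p_i)$ have zero constant term). Then there exists a sequence $\{\tau_k\}_{k\ge 1}$ of tame symplectomorphisms, $\tau_k\in \mathrm{TAut}\,P_n(\mathbb{K})$, which converges to $\sigma$ in the formal power series topology.
   Context: $P_n(\mathbb{K})$ is the polynomial algebra $\mathbb{K}[x_1,\ldots,x_n,p_1,\ldots,p_n]$ with the standard Poisson bracket: the biderivation with $\{p_i,x_j\}=\delta_{ij}$, $\{x_i,x_j\}=\{p_i,p_j\}=0$. A polynomial symplectomorphism is a $\mathbb{K}$-algebra automorphism preserving this bracket (equivalently, the symplectic form $\omega=\sum_i dp_i\wedge dx_i$). Endomorphisms are identified with the tuples of images of the generators. The Jacobian of $\sigma$ is the determinant of the $2n\times 2n$ matrix of partial derivatives of the images of the generators. Tame symplectomorphisms: $\mathrm{TAut}\,P_n(\mathbb{K})$ is the subgroup of the group of polynomial symplectomorphisms generated by the symplectomorphisms of the following forms: (i) linear symplectic changes of variables $(x_1,\ldots,x_n,p_1,\ldots,p_n)\mapsto(x_1,\ldots,x_n,p_1,\ldots,p_n)A$ with $A\in \mathrm{Sp}(2n,\mathbb{K})$; (ii) elementary transformations $(x_1,\ldots,x_{k-1},x_k+f(p_1,\ldots,p_n),x_{k+1},\ldots,x_n,p_1,\ldots,p_n)$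 that preserve the bracket; (iii) elementary transformations $(x_1,\ldots,x_n,p_1,\ldots,p_{k-1},p_k+g(x_1,\ldots,x_n),p_{k+1},\ldots,p_n)$ that preserve the bracket. Here $f$ and $g$ are polynomials with zero constant term (translations are not included). Height: the height $\mathrm{ht}(f)$ of a polynomial $f$ is the least $k$ such that its homogeneous component of total degree $k$ is nonzero (all generators have degree 1), $\mathrm{ht}(0)=\infty$; for a tuple it is the minimum of the heights of the entries. The formal power series topology is given by the metric $d(\varphi,\psi)=\exp(-\mathrm{ht}(\varphi-\psi))$, with $\varphi-\psi$ the tuple of entrywise differences. *)

(* Defs.v *)
From Stdlib Require Reals.
From mathcomp Require Import all_boot all_order all_algebra.
From mathcomp Require Import mpoly.

Set Implicit Arguments.
Unset Strict Implicit.
Unset Printing Implicit Defensive.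

Import GRing.Theory.
Local Open Scope ring_scope.

(* P_n(K) = K[x_1, ..., x_n, p_1, ..., p_n] as a polynomial ring in n + n
   variables: the first n are the x_i, the last n are the p_i. *)
Definition xidx n (i : 'I_n) : 'I_(n + n) := lshift n i.
Definition pidx n (i : 'I_n) : 'I_(n + n) := rshift n i.

(* The sign convention is {p_i, x_j} = delta_ij, see [poisson_px]; the lemmas
   following the definition say that this is the biderivation with the
   prescribed values on the generators. *)
Definition poisson (K : fieldType) n (f g : {mpoly K[n + n]}) :
    {mpoly K[n + n]} :=
  \sum_(i < n) (f^`M(pidx i) * g^`M(xidx i) - f^`M(xidx i) * g^`M(pidx i)).

Section PoissonFacts.
Variables (K : fieldType) (n : nat).
Implicit Types (f g h : {mpoly K[n + n]}) (i j : 'I_n).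

Lemma poissonN f g : poisson f g = - poisson g f.
Proof.
rewrite /poisson -sumrN; apply: eq_bigr => i _.
by rewrite opprB mulrC [X in _ - X]mulrC.
Qed.

Lemma poissonDl f g h : poisson (f + g) h = poisson f h + poisson g h.
Proof.
rewrite /poisson -big_split; apply: eq_bigr => i _ /=.
by rewrite !mderivD !mulrDl opprD addrACA.
Qed.

Lemma poissonZl (c : K) f h : poisson (c *: f) h = c *: poisson f h.
Proof.
rewrite /poisson scaler_sumr; apply: eq_bigr => i _ /=.
by rewrite !mderivZ -!scalerAl scalerBr.
Qed.

Lemma poissonMl f g h : poisson (f * g) h = f * poisson g h + g * poisson f h.
Proof.
rewrite /poisson !mulr_sumr -big_split; apply: eq_bigr => i _ /=.
rewrite !mderivM !mulrDl !mulrBr opprD addrACA !mulrA.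
by rewrite ![_^`M(_) * g]mulrC addrC.
Qed.

Let mderivXU (a b : 'I_(n + n)) : ('X_a : {mpoly K[n + n]})^`M(b) = (a == b)%:R.
Proof.
rewrite mderivX mnm1E; case: eqP => [->|_]; last by rewrite scale0r.
by rewrite scale1r -{1}[U_(b)%MM]add0m addmK mpolyX0.
Qed.

Lemma poisson_px i j : poisson 'X_(pidx i) 'X_(xidx j) = (i == j)%:R :> {mpoly K[n + n]}.
Proof.
rewrite /poisson (bigD1 i) //= big1 => [|k ki]; rewrite !mderivXU /pidx /xidx.
  rewrite eq_rshift eqxx mul1r eq_lshift eq_rlshift mul0r subr0 addr0.
  by rewrite eq_sym.
by rewrite eq_rshift eq_rlshift eq_sym (negPf ki) !mul0r subr0.
Qed.

Lemma poisson_xx i j : poisson 'X_(xidx i) 'X_(xidx j) = 0 :> {mpoly K[n + n]}.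
Proof.
by rewrite /poisson big1 // => k _; rewrite !mderivXU eq_lrshift mul0r
  [_ == pidx _]eq_lrshift mulr0 subr0.
Qed.

Lemma poisson_pp i j : poisson 'X_(pidx i) 'X_(pidx j) = 0 :> {mpoly K[n + n]}.
Proof.
by rewrite /poisson big1 // => k _; rewrite !mderivXU [_ == xidx _]eq_rlshift
  mulr0 [_ == xidx _]eq_rlshift mul0r subr0.
Qed.
End PoissonFacts.

(* A K-algebra endomorphism of P_n(K) is given by the tuple of the images of
   the generators; the endomorphism itself is [fun h => h \mPo phi]. *)
Definition endo (K : fieldType) n := (n + n).-tuple {mpoly K[n + n]}.

Definition endo_id (K : fieldType) n : endo K n := [tuple 'X_i | i < n + n].

Definition endo_comp (K : fieldType) n (phi psi : endo K n) : endo K n :=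
  [tuple tnth psi i \mPo phi | i < n + n].

Lemma endo_compE (K : fieldType) n (phi psi : endo K n) (h : {mpoly K[n + n]}) :
  h \mPo endo_comp phi psi = (h \mPo psi) \mPo phi.
Proof.
rewrite (comp_mpolyE h psi) raddf_sum /= comp_mpolyE; apply: eq_bigr => m _.
rewrite comp_mpolyZ rmorph_prod; congr (_ *: _); apply: eq_bigr => i _.
by rewrite rmorphXn tnth_mktuple.
Qed.

Definition symplectomorphism (K : fieldType) n (phi : endo K n) : Prop :=
  bijective (fun h : {mpoly K[n + n]} => h \mPo phi) /\
  forall f g : {mpoly K[n + n]},
    poisson (f \mPo phi) (g \mPo phi) = poisson f g \mPo phi.

Definition jacobian (K : fieldType) n (phi : endo K n) : {mpoly K[n + n]} :=
  \det (\matrix_(i < n + n, j < n + n) (tnth phi i)^`M(j)).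

Definition origin_preserving (K : fieldType) n (phi : endo K n) : Prop :=
  forall i : 'I_(n + n), (tnth phi i)@_0%MM = 0.

Definition symplectic_mx (K : fieldType) n (A : 'M[K]_(n + n)) : Prop :=
  let J : 'M[K]_(n + n) := block_mx 0 1%:M (- 1%:M) 0 in A^T *m J *m A = J.

(* The row vector (x_1, ..., x_n, p_1, ..., p_n) A. *)
Definition linear_endo (K : fieldType) n (A : 'M[K]_(n + n)) : endo K n :=
  [tuple \sum_(i < n + n) A i j *: 'X_i | j < n + n].

(* x_k |-> x_k + f(p_1, ..., p_n), the other generators being fixed. *)
Definition elem_x (K : fieldType) n (k : 'I_n) (f : {mpoly K[n]}) : endo K n :=
  [tuple if i == xidx k then 'X_i + (f \mPo [tuple 'X_(pidx j) | j < n])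
         else 'X_i | i < n + n].

(* p_k |-> p_k + g(x_1, ..., x_n), the other generators being fixed. *)
Definition elem_p (K : fieldType) n (k : 'I_n) (g : {mpoly K[n]}) : endo K n :=
  [tuple if i == pidx k then 'X_i + (g \mPo [tuple 'X_(xidx j) | j < n])
         else 'X_i | i < n + n].

Variant tame_generator (K : fieldType) n : endo K n -> Prop :=
| TameLinear (A : 'M[K]_(n + n)) of
    symplectic_mx A : tame_generator (linear_endo A)
| TameElemX (k : 'I_n) (f : {mpoly K[n]}) of
    f@_0%MM = 0 & symplectomorphism (elem_x k f) : tame_generator (elem_x k f)
| TameElemP (k : 'I_n) (g : {mpoly K[n]}) of
    g@_0%MM = 0 & symplectomorphism (elem_p k g) : tame_generator (elem_p k g).

(* TAut P_n(K), the subgroup generated by the elements above. *)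
Inductive tame (K : fieldType) n : endo K n -> Prop :=
| tame_gen phi of tame_generator phi : tame phi
| tame_id : tame (endo_id K n)
| tame_comp phi psi of tame phi & tame psi : tame (endo_comp phi psi)
| tame_inv phi psi of tame phi & endo_comp phi psi = endo_id K n
    & endo_comp psi phi = endo_id K n : tame psi.

Lemma height_exists (K : fieldType) m (f : {mpoly K[m]}) :
  f != 0 -> exists k, pihomog mdeg k f != 0.
Proof.
move=> f_neq0; pose nz (k : 'I_(msize f)) := pihomog mdeg k f != 0.
have [/existsP[k fk]|] := boolP [exists k, nz k]; first by exists k.
rewrite negb_exists => /forallP f_hom0; case/eqP: f_neq0.
rewrite [LHS](pihomog_partitionE (leqnn (msize f))).
by apply: big1 => k _; apply/eqP; rewrite -[_ == _]negbK f_hom0.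
Qed.

(* Heights take values in nat together with infinity, encoded as [None]. *)
Definition height (K : fieldType) m (f : {mpoly K[m]}) : option nat :=
  match boolP (f != 0) with
  | AltTrue f_neq0 => Some (ex_minn (height_exists f_neq0))
  | AltFalse _ => None
  end.

Definition height_min (a b : option nat) : option nat :=
  match a, b with
  | Some i, Some j => Some (minn i j)
  | Some i, None => Some i
  | None, _ => b
  end.

Definition tuple_height (K : fieldType) n (phi : endo K n) : option nat :=
  \big[height_min/None]_(i < n + n) height (tnth phi i).

Definition endo_sub (K : fieldType) n (phi psi : endo K n) : endo K n :=
  [tuple tnth phi i - tnth psi i | i < n + n].

(* d(phi, psi) = exp (- ht (phi - psi)), with exp (- infinity) = 0. *)
Definition endo_dist (K : fieldType) n (phi psi : endo K n) : Rdefinitions.R :=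
  match tuple_height (endo_sub phi psi) with
  | Some k => Rtrigo_def.exp (Rdefinitions.Ropp (Raxioms.INR k))
  | None => Rdefinitions.R0
  end.

Definition endo_cvg (K : fieldType) n (tau : nat -> endo K n)
    (sigma : endo K n) : Prop :=
  Rseries.Un_cv (fun k => endo_dist (tau k) sigma) Rdefinitions.R0.

(* Main.v *)
(* The linear part of sigma is symplectic, so after composing with its inverse
   sigma is the identity up to height 2. If sigma is the identity up to height
   M >= 2, preservation of the bracket forces sigma(z_i) = z_i + {H, z_i} up to
   height M + 1, with H of height at least M + 1 (Poincare lemma). In
   characteristic zero, monomials of degree M + 1 are linear combinations of
   powers of linear forms l in which the coefficient of x_1 is 1. For such l
   the flow of c l^(M+1) is the shear z_i + c (M+1) l^M {l, z_i}, conjugate of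
   an elementary transformation x_1 + c (M+1) p_1^M by a symplectic transvection
   sending p_1 to l. Composing these shears gives a tame map agreeing with sigma
   up to height M + 1; compose with its inverse and iterate. *)
Require Import Defs.
From mathcomp Require Import all_boot all_order all_algebra.
From Stdlib Require IndefiniteDescription Reals.
From mathcomp Require Import mpoly ring zify.

Set Implicit Arguments.
Unset Strict Implicit.
Unset Printing Implicit Defensive.

Import GRing.Theory.
Local Open Scope ring_scope.

(** * The filtration by height, and its behaviour under substitution *)

Section HeightGe.
Variable K : fieldType.

(** Stated on coefficients rather than through [height]: this condition is linear in f and treats f
    = 0 without a case distinction. *)
Definition height_ge m (N : nat) (f : {mpoly K[m]}) : Prop :=
  forall k : 'X_{1..m}, (mdeg k < N)%N -> f@_k = 0.

Section Closure.
Variable m : nat.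
Implicit Types (f g u v : {mpoly K[m]}) (N M d e : nat).

Lemma height_geW M N f : (N <= M)%N -> height_ge M f -> height_ge N f.
Proof. by move=> NM fM k kN; apply: fM; apply: leq_trans NM. Qed.

Lemma height_ge0 N : height_ge N (0 : {mpoly K[m]}).
Proof. by move=> k _; rewrite mcoeff0. Qed.

Lemma height_ge_deg0 f : height_ge 0 f.
Proof. by []. Qed.

Lemma height_geD N f g : height_ge N f -> height_ge N g -> height_ge N (f + g).
Proof. by move=> fN gN k kN; rewrite mcoeffD fN // gN // addr0. Qed.

Lemma height_geZ N c f : height_ge N f -> height_ge N (c *: f).
Proof. by move=> fN k kN; rewrite mcoeffZ fN // mulr0. Qed.

Lemma height_geN N f : height_ge N f -> height_ge N (- f).
Proof. by move=> fN k kN; rewrite mcoeffN fN // oppr0. Qed.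

Lemma height_geB N f g : height_ge N f -> height_ge N g -> height_ge N (f - g).
Proof. by move=> fN gN; apply/height_geD/height_geN. Qed.

Lemma height_ge_sum N (I : Type) (r : seq I) (P : pred I)
    (F : I -> {mpoly K[m]}) :
  (forall i, P i -> height_ge N (F i)) -> height_ge N (\sum_(i <- r | P i) F i).
Proof.
by move=> FN; elim/big_ind: _ => //; [apply: height_ge0 | apply: height_geD].
Qed.

Lemma height_geM N M f g :
  height_ge N f -> height_ge M g -> height_ge (N + M) (f * g).
Proof.
move=> fN gM k kNM; rewrite mcoeffM big1 // => -[k1 k2] /eqP /= kE.
have [k1N|k1N] := ltnP (mdeg k1) N; first by rewrite fN // mul0r.
rewrite gM ?mulr0 //; move/(congr1 (@mdeg m)): kE kNM; rewrite mdegD; lia.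
Qed.

Lemma height_geX1 i : height_ge 1 ('X_i : {mpoly K[m]}).
Proof.
move=> k; rewrite ltnS leqn0 mdeg_eq0 => /eqP->.
by rewrite mcoeffX; case: eqP => // /(congr1 (@mdeg m)); rewrite mdeg1 mdeg0.
Qed.

Lemma height_ge1P f : height_ge 1 f <-> f@_0%MM = 0.
Proof.
split=> [->//|f0 k]; first by rewrite mdeg0.
by rewrite ltnS leqn0 mdeg_eq0 => /eqP->.
Qed.

Lemma height_ge_deriv N i f : height_ge N.+1 f -> height_ge N f^`M(i).
Proof.
move=> fN k kN; rewrite mcoeff_mderiv fN ?mul0rn //.
by rewrite mdegD mdeg1 addn1.
Qed.

(* Congruence to relative order [e] of quantities of height at least [d]: it
   is stable under products, the heights being added. *)
Definition close d e u v :=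
  [/\ height_ge d u, height_ge d v & height_ge (d + e) (u - v)].

Lemma closeM d1 d2 e u1 v1 u2 v2 :
  close d1 e u1 v1 -> close d2 e u2 v2 -> close (d1 + d2) e (u1 * u2) (v1 * v2).
Proof.
move=> [u1d v1d uv1] [u2d v2d uv2]; split; try exact: height_geM.
have -> : u1 * u2 - v1 * v2 = u1 * (u2 - v2) + (u1 - v1) * v2 by ring.
apply: height_geD; first by rewrite -addnA; apply: height_geM.
by rewrite addnAC; apply: height_geM.
Qed.

Lemma close1 e : close 0 e 1 1.
Proof. by split=> //; rewrite subrr; apply: height_ge0. Qed.

Lemma closeX d e u v k : close d e u v -> close (k * d) e (u ^+ k) (v ^+ k).
Proof.
move=> uv; elim: k => [|k IHk]; first exact: close1.
by rewrite mulSn !exprS; apply: closeM.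
Qed.

End Closure.

(** Substitution in a monomial of degree k is a product of k factors, so [closeM] gives heights k d
    and relative order e; only degrees k >= N occur in f. *)
Lemma close_comp m p d e N (g h : m.-tuple {mpoly K[p]}) (f : {mpoly K[m]}) :
    (forall i, close d e (tnth g i) (tnth h i)) -> height_ge N f ->
  height_ge (N * d + e) ((f \mPo g) - (f \mPo h)) /\
  height_ge (N * d) (f \mPo g).
Proof.
move=> gh fN.
have monom k : close (mdeg k * d) e ('X_[k] \mPo g) ('X_[k] \mPo h).
  rewrite !comp_mpolyX mdegE big_distrl /=.
  apply: (big_rec3 (fun D u v => @close p D e u v)) => [|i D u v _ IH].
    exact: close1.
  by apply: closeM => //; apply: closeX.
have supp k : k \in msupp f -> (N * d <= mdeg k * d)%N.
  move=> kf; rewrite leq_mul2r orbC; case: leqP => // kN.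
  by move: kf; rewrite mcoeff_msupp fN ?eqxx.
split; rewrite !comp_mpolyEX -?sumrB big_seq; apply: height_ge_sum => k kf.
  rewrite -scalerBr; apply: height_geZ; have [_ _] := monom k.
  by apply: height_geW; rewrite leq_add2r supp.
by apply: height_geZ; have [+ _ _] := monom k; apply: height_geW; apply: supp.
Qed.

Lemma height_ge_comp m p N (f : {mpoly K[m]}) (g : m.-tuple {mpoly K[p]}) :
  height_ge N f -> (forall i, height_ge 1 (tnth g i)) -> height_ge N (f \mPo g).
Proof.
move=> fN g1; rewrite -(muln1 N).
apply: (proj2 (@close_comp m p 1 0 N g g f _ fN)) => i.
by split=> //; rewrite subrr; apply: height_ge0.
Qed.

(** f minus its constant term has height at least 1, and keeps it under an origin-preserving
    substitution. *)
Lemma mcoeff0_comp m p (f : {mpoly K[m]}) (g : m.-tuple {mpoly K[p]}) :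
  (forall i, height_ge 1 (tnth g i)) -> (f \mPo g)@_0%MM = f@_0%MM.
Proof.
move=> g1; have f1 : height_ge 1 (f - (f@_0%MM)%:MP).
  by apply/height_ge1P; rewrite mcoeffB mcoeffC eqxx mulr1 subrr.
have /height_ge1P := height_ge_comp f1 g1.
rewrite comp_mpolyB comp_mpolyC mcoeffB mcoeffC eqxx mulr1.
by move/eqP; rewrite subr_eq0 => /eqP.
Qed.

End HeightGe.

(** * The bracket in coordinates, the chain rule, and bracket-preserving endomorphisms *)

Section Poisson.
Variables (K : fieldType) (n : nat).
Implicit Types (f g h : {mpoly K[n + n]}) (i j a b : 'I_(n + n)).
Implicit Types (phi psi : endo K n).

(* With z = (x, p), {f, z_j} = dsign j * df/dz_(dual j). *)
Definition dual i : 'I_(n + n) :=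
  match split i with inl k => pidx k | inr k => xidx k end.

Definition dsign i : K := if split i is inl _ then 1 else -1.

Lemma dual_xidx (k : 'I_n) : dual (xidx k) = pidx k.
Proof.
rewrite /dual /xidx; case: splitP => l /= => [/val_inj->//|].
by have := ltn_ord k; lia.
Qed.

Lemma dual_pidx (k : 'I_n) : dual (pidx k) = xidx k.
Proof.
rewrite /dual /pidx; case: splitP => l /= kl; first by have := ltn_ord l; lia.
by congr xidx; apply: val_inj => /=; lia.
Qed.

Lemma dsign_xidx (k : 'I_n) : dsign (xidx k) = 1.
Proof.
by rewrite /dsign /xidx; case: splitP => l //=; have := ltn_ord k; lia.
Qed.

Lemma dsign_pidx (k : 'I_n) : dsign (pidx k) = -1.
Proof.
by rewrite /dsign /pidx; case: splitP => l //=; have := ltn_ord l; lia.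
Qed.

Lemma idx_ind (P : 'I_(n + n) -> Prop) :
  (forall k, P (xidx k)) -> (forall k, P (pidx k)) -> forall i, P i.
Proof.
move=> Px Pp i; rewrite -(splitK i).
by case: (split i) => k; [apply: Px | apply: Pp].
Qed.

Lemma dualK : involutive dual.
Proof.
by elim/idx_ind => k; rewrite !(dual_xidx, dual_pidx).
Qed.

Lemma dsignK i : dsign i * dsign i = 1.
Proof.
by elim/idx_ind: i => k; rewrite ?dsign_xidx ?dsign_pidx ?mulrNN mulr1.
Qed.

Lemma mderivXU m (a b : 'I_m) : ('X_a : {mpoly K[m]})^`M(b) = (a == b)%:R.
Proof.
rewrite mderivX mnm1E; case: eqP => [->|_]; last by rewrite scale0r.
by rewrite scale1r -{1}[U_(b)%MM]add0m addmK mpolyX0.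
Qed.

Lemma poissonE f g :
  poisson f g = \sum_j dsign j *: (f^`M(dual j) * g^`M(j)).
Proof.
rewrite big_split_ord /= -big_split; apply: eq_bigr => k _ /=.
rewrite -/(xidx k) -/(pidx k) !(dual_xidx, dual_pidx, dsign_xidx, dsign_pidx).
by rewrite scale1r scaleN1r.
Qed.

Lemma poissonX f j : poisson f 'X_j = dsign j *: f^`M(dual j).
Proof.
rewrite poissonE (bigD1 j) //= big1 => [|k kj]; rewrite mderivXU.
  by rewrite eqxx mulr1 addr0.
by rewrite eq_sym (negPf kj) mulr0 scaler0.
Qed.

Lemma poissonXX i j :
  poisson 'X_i 'X_j = (dsign j * (i == dual j)%:R)%:MP :> {mpoly K[n + n]}.
Proof. by rewrite poissonX mderivXU -mul_mpolyC mpolyCM mpolyC_nat. Qed.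

Lemma poisson_derivr f g : poisson f g = \sum_j poisson f 'X_j * g^`M(j).
Proof.
by rewrite poissonE; apply: eq_bigr => j _; rewrite poissonX scalerAl.
Qed.

Lemma poisson_derivl f g : poisson f g = \sum_i f^`M(i) * poisson 'X_i g.
Proof.
rewrite poissonN poisson_derivr -sumrN; apply: eq_bigr => i _.
by rewrite [poisson g _]poissonN mulNr opprK mulrC.
Qed.

Lemma poissonDr f g h : poisson h (f + g) = poisson h f + poisson h g.
Proof. by rewrite poissonN poissonDl opprD -!poissonN. Qed.

Lemma poissonZr (c : K) f h : poisson h (c *: f) = c *: poisson h f.
Proof. by rewrite poissonN poissonZl -scalerN -poissonN. Qed.

Lemma poisson_suml (I : Type) (r : seq I) (P : pred I) (F : I -> _) h :
  poisson (\sum_(i <- r | P i) F i) h = \sum_(i <- r | P i) poisson (F i) h.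
Proof.
elim/big_rec2: _ => [|i u v _ <-]; last by rewrite poissonDl.
by rewrite -(scale0r 0) poissonZl !scale0r.
Qed.

(** Chain rule: the polynomials satisfying it contain 1 and the generators, and are closed under
    sums, scalings and products. *)
Lemma mderiv_comp m p (f : {mpoly K[m]}) (g : m.-tuple {mpoly K[p]})
    (j : 'I_p) :
  (f \mPo g)^`M(j) = \sum_i (f^`M(i) \mPo g) * (tnth g i)^`M(j).
Proof.
pose D (u : {mpoly K[m]}) :=
  (u \mPo g)^`M(j) = \sum_i (u^`M(i) \mPo g) * (tnth g i)^`M(j).
have D0 : D 0.
  rewrite /D comp_mpoly0 mderiv0 big1 // => i _.
  by rewrite mderiv0 comp_mpoly0 mul0r.
have DD u v : D u -> D v -> D (u + v).
  rewrite /D comp_mpolyD mderivD => -> ->; rewrite -big_split.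
  by apply: eq_bigr => i _; rewrite mderivD comp_mpolyD mulrDl.
have DZ c u : D u -> D (c *: u).
  rewrite /D comp_mpolyZ mderivZ => ->; rewrite scaler_sumr.
  by apply: eq_bigr => i _; rewrite mderivZ comp_mpolyZ scalerAl.
have DM u v : D u -> D v -> D (u * v).
  rewrite /D rmorphM mderivM /= => -> ->; rewrite mulr_suml mulr_sumr.
  rewrite -big_split; apply: eq_bigr => i _ /=.
  by rewrite mderivM comp_mpolyD !rmorphM /=; ring.
have D1 : D 1.
  rewrite /D comp_mpoly1 -mpolyC1 mderivC big1 // => i _.
  by rewrite mderivC comp_mpoly0 mul0r.
have DX (i : 'I_m) : D 'X_i.
  rewrite /D comp_mpolyXU -tnth_nth (bigD1 i) //= big1 => [|k ki].
    by rewrite mderivXU eqxx comp_mpoly1 mul1r addr0.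
  by rewrite mderivXU eq_sym (negPf ki) comp_mpoly0 mul0r.
rewrite -/(D f) (mpolyE f); apply: (big_ind D D0 DD) => k _; apply: DZ.
rewrite mpolyXE_id; apply: (big_ind D D1 DM) => i _.
elim: (k i) => [|e De]; first exact: D1.
by rewrite exprS; apply: DM.
Qed.

Definition preserves_poisson phi :=
  forall f g, poisson (f \mPo phi) (g \mPo phi) = poisson f g \mPo phi.

Lemma poisson_compl m (f : {mpoly K[m]}) (phi : m.-tuple {mpoly K[n + n]}) h :
  poisson (f \mPo phi) h = \sum_i (f^`M(i) \mPo phi) * poisson (tnth phi i) h.
Proof.
rewrite poissonE.
under eq_bigr do rewrite mderiv_comp mulr_suml scaler_sumr.
rewrite exchange_big; apply: eq_bigr => i _ /=; rewrite poissonE mulr_sumr.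
by apply: eq_bigr => j _; rewrite -mulrA scalerAr.
Qed.

(** By the chain rule in each argument, both sides are determined by the brackets of the images of
    the generators. *)
Lemma preserves_poisson_gen phi :
    (forall i j, poisson (tnth phi i) (tnth phi j) =
                 (dsign j * (i == dual j)%:R)%:MP) ->
  preserves_poisson phi.
Proof.
move=> phiX f g; rewrite poisson_compl poisson_derivl raddf_sum /=.
apply: eq_bigr => i _; rewrite rmorphM /=; congr (_ * _).
rewrite poissonN poisson_compl -sumrN [in RHS]poisson_derivr raddf_sum /=.
apply: eq_bigr => j _; rewrite rmorphM /= poissonXX comp_mpolyC -phiX.
by rewrite -mulrN -poissonN mulrC.
Qed.

Lemma tnth_comp phi psi i : tnth (endo_comp phi psi) i = tnth psi i \mPo phi.
Proof. by rewrite tnth_mktuple. Qed.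

Lemma tnth_id i : tnth (endo_id K n) i = 'X_i.
Proof. by rewrite tnth_mktuple. Qed.

Lemma comp_endo_id f : f \mPo endo_id K n = f.
Proof. exact: comp_mpoly_id. Qed.

Lemma comp_endo_cancel phi psi :
  endo_comp phi psi = endo_id K n -> forall f, (f \mPo psi) \mPo phi = f.
Proof. by move=> phiK f; rewrite -endo_compE phiK comp_endo_id. Qed.

Lemma preserves_poisson_tnth phi i j : preserves_poisson phi ->
  poisson (tnth phi i) (tnth phi j) = (dsign j * (i == dual j)%:R)%:MP.
Proof.
move=> phiP; have := phiP 'X_i 'X_j.
by rewrite !comp_mpolyXU -!tnth_nth poissonXX comp_mpolyC.
Qed.

Lemma preserves_poisson_comp phi psi :
  preserves_poisson phi -> preserves_poisson psi ->
  preserves_poisson (endo_comp phi psi).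
Proof. by move=> phiP psiP f g; rewrite !endo_compE phiP psiP. Qed.

End Poisson.

(** * Linear forms, symplectic matrices and shears *)

Section LinearForms.
Variables (K : fieldType) (n : nat).
Implicit Types (i j : 'I_(n + n)) (b w : 'I_(n + n) -> K).
Implicit Types (A B : 'M[K]_(n + n)).

Definition linform b : {mpoly K[n + n]} := \sum_i b i *: 'X_i.

Lemma eq_linform b b' : b =1 b' -> linform b = linform b'.
Proof. by move=> bb'; apply: eq_bigr => i _; rewrite bb'. Qed.

Lemma linformX i : linform (fun j => (j == i)%:R) = 'X_i.
Proof.
rewrite /linform (bigD1 i) //= eqxx scale1r big1 ?addr0 // => j /negPf->.
by rewrite scale0r.
Qed.

Lemma linformD b b' : linform b + linform b' = linform (fun i => b i + b' i).
Proof. by rewrite -big_split; apply: eq_bigr => i _; rewrite scalerDl. Qed.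

Lemma linformZ c b : c *: linform b = linform (fun i => c * b i).
Proof. by rewrite scaler_sumr; apply: eq_bigr => i _; rewrite scalerA. Qed.

Lemma linform_comp b (phi : endo K n) :
  linform b \mPo phi = \sum_i b i *: tnth phi i.
Proof.
rewrite raddf_sum; apply: eq_bigr => i _ /=.
by rewrite comp_mpolyZ comp_mpolyXU -tnth_nth.
Qed.

Lemma height_ge_linform b : height_ge 1 (linform b).
Proof. by apply: height_ge_sum => i _; apply/height_geZ/height_geX1. Qed.

Lemma mderiv_linform b j : (linform b)^`M(j) = (b j)%:MP.
Proof.
rewrite raddf_sum (bigD1 j) //= big1 => [|i /negPf ij].
  by rewrite mderivZ mderivXU eqxx -mul_mpolyC mulr1 addr0.
by rewrite mderivZ mderivXU ij scaler0.
Qed.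

Lemma poisson_linformX b j :
  poisson (linform b) 'X_j = (dsign K j * b (dual j))%:MP.
Proof.
by rewrite poissonX mderiv_linform -mul_mpolyC -mpolyCM.
Qed.

Lemma tnth_linear A j : tnth (linear_endo A) j = linform (A^~ j).
Proof. by rewrite tnth_mktuple. Qed.

Lemma linear_comp A B :
  endo_comp (linear_endo A) (linear_endo B) = linear_endo (A *m B).
Proof.
apply: eq_from_tnth => j; rewrite tnth_comp !tnth_linear linform_comp.
under eq_bigr do rewrite tnth_linear scaler_sumr.
rewrite exchange_big; apply: eq_bigr => i _; rewrite mxE scaler_suml.
by apply: eq_bigr => k _; rewrite scalerA mulrC.
Qed.

Lemma linear1 : linear_endo 1%:M = endo_id K n.
Proof.
apply: eq_from_tnth => j; rewrite tnth_linear tnth_id -linformX.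
by apply: eq_linform => i; rewrite mxE.
Qed.

Definition symp_form : 'M[K]_(n + n) := block_mx 0 1%:M (- 1%:M) 0.

(** The entries of J are the opposites of the {z_i, z_j}, because of the convention {p_i, x_i} =
    1. *)
Lemma symp_formE i j : symp_form i j = - (dsign K j * (i == dual j)%:R).
Proof.
elim/idx_ind: i => k; elim/idx_ind: j => l;
  rewrite !(dual_xidx, dual_pidx, dsign_xidx, dsign_pidx) /symp_form
    ?block_mxEul ?block_mxEur ?block_mxEdl ?block_mxEdr !mxE /xidx /pidx
    ?eq_lshift ?eq_rshift ?eq_lrshift ?eq_rlshift;
  by rewrite ?mul1r ?mulN1r ?opprK ?oppr0.
Qed.

Lemma symp_form_sqr : symp_form *m symp_form = - 1%:M.
Proof.
rewrite mulmx_block !mulmx0 !mul0mx !mul1mx mulNmx mul1mx !addr0 !add0r.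
by rewrite scalar_mx_block opp_block_mx !oppr0.
Qed.

Lemma poisson_linear A i j :
  poisson (tnth (linear_endo A) i) (tnth (linear_endo A) j) =
  (- (A^T *m symp_form *m A) i j)%:MP.
Proof.
rewrite !tnth_linear poissonE mxE -sumrN raddf_sum /=.
apply: eq_bigr => k _; rewrite !mderiv_linform -mul_mpolyC -!mpolyCM.
congr _%:MP; rewrite mxE (bigD1 (dual k)) //= big1 => [|l /negPf lk].
  by rewrite addr0 mxE symp_formE eqxx mulr1 mulrN mulNr opprK mulrCA mulrA.
by rewrite symp_formE lk mulr0 oppr0 mulr0.
Qed.

(** The entries of A^T J A are the opposites of the brackets of the images of the generators. *)
Lemma symplectic_mxP A :
  symplectic_mx A <-> preserves_poisson (linear_endo A).
Proof.
split=> [AJ|Apres].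
  apply: preserves_poisson_gen => i j; rewrite poisson_linear.
  by rewrite [_ *m A]AJ -/symp_form symp_formE opprK.
apply/matrixP => i j; apply: oppr_inj.
have := preserves_poisson_tnth i j Apres; rewrite poisson_linear.
move=> /(congr1 (mcoeff 0%MM)); rewrite !mcoeffC eqxx !mulr1 => ->.
by rewrite -/symp_form symp_formE opprK.
Qed.

(** Since J^2 = -1, the relation A^T J A = J exhibits - J A^T J as inverse. *)
Lemma symplectic_mx_inv A : symplectic_mx A ->
  exists2 B, B *m A = 1%:M & A *m B = 1%:M.
Proof.
move=> AJ; exists (- (symp_form *m A^T *m symp_form)).
  by rewrite mulNmx -!mulmxA (mulmxA _ _ A) AJ symp_form_sqr opprK.
apply: mulmx1C.
  by rewrite mulNmx -!mulmxA (mulmxA _ _ A) AJ symp_form_sqr opprK.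
Qed.

Lemma linear_endo_inv A : symplectic_mx A ->
  exists2 B, endo_comp (linear_endo A) (linear_endo B) = endo_id K n
           & endo_comp (linear_endo B) (linear_endo A) = endo_id K n.
Proof.
case/symplectic_mx_inv => B BA AB.
by exists B; rewrite linear_comp ?BA ?AB linear1.
Qed.

Lemma poissonXnl (f h : {mpoly K[n + n]}) e :
  poisson (f ^+ e.+1) h = e.+1%:R *: (f ^+ e * poisson f h).
Proof.
elim: e => [|e IHe]; first by rewrite scale1r mul1r expr1.
rewrite exprS poissonMl IHe -scalerAr mulrA -exprS.
by rewrite -{2}[_ * _]scale1r -scalerDl -(natrD _ _ 1%N) addn1.
Qed.

Lemma poisson_self (f : {mpoly K[n + n]}) : poisson f f = 0.
Proof.
by rewrite /poisson big1 // => k _; rewrite mulrC subrr.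
Qed.

(* The time-one Hamiltonian flow of c/(e+1) l^(e+1), where l = linform b. *)
Definition shear b (c : K) e : endo K n :=
  [tuple 'X_i + c *: (poisson (linform b) 'X_i * linform b ^+ e) | i < n + n].

Lemma tnth_shear b c e i :
  tnth (shear b c e) i =
  'X_i + c *: (poisson (linform b) 'X_i * linform b ^+ e).
Proof. by rewrite tnth_mktuple. Qed.

(** With L = l^(e+1) and constants a_i = {l, z_i}, one has {L, z_i} = a_i D for a common D; the two
    terms linear in c cancel by antisymmetry, and the quadratic one contains {L, L} = 0. *)
Lemma shear_preserves b c e : preserves_poisson (shear b c e.+1).
Proof.
apply: preserves_poisson_gen => i j; rewrite !tnth_shear.
set l := linform b; set a := fun i => dsign K i * b (dual i).
have lX k : poisson l 'X_k = (a k)%:MP by rewrite poisson_linformX.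
pose L := l ^+ e.+1; pose D := e.+1%:R *: l ^+ e.
have LX k : poisson L 'X_k = a k *: D.
  by rewrite poissonXnl lX [_ * _%:MP]mulrC mul_mpolyC /D !scalerA mulrC.
rewrite !lX -/L !mul_mpolyC !scalerA poissonDl !poissonDr !poissonZl !poissonZr.
rewrite poisson_self !scaler0 addr0 [poisson _ L]poissonN !LX poissonXX.
by rewrite scalerN !scalerA [c * a j * _]mulrAC subrK.
Qed.

Lemma linform_shear b b' c e :
  linform b' \mPo shear b c e =
  linform b' + c *: (poisson (linform b) (linform b') * linform b ^+ e).
Proof.
rewrite linform_comp; under eq_bigr do rewrite tnth_shear scalerDr.
rewrite big_split /=; congr (_ + _); rewrite [poisson _ (linform b')]poissonN.
rewrite poisson_suml -sumrN mulr_suml scaler_sumr; apply: eq_bigr => i _.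
by rewrite poissonZl -scalerN -poissonN -scalerAl !scalerA mulrC.
Qed.

End LinearForms.

(** * Properties of tame maps, and tameness of shears *)

Section Tame.
Variables (K : fieldType) (n : nat).
Implicit Types (i j : 'I_(n + n)) (b w : 'I_(n + n) -> K).
Implicit Types (A : 'M[K]_(n + n)) (phi psi : endo K n).

Lemma tame_preserves phi : tame phi -> preserves_poisson phi.
Proof.
elim=> {phi} [_ [A /symplectic_mxP//|k f _ []//|k f _ []//]||phi psi _ + _ |].
- by move=> f g; rewrite !comp_endo_id.
- exact: preserves_poisson_comp.
(* For an inverse, substitute [phi] and then [psi] in the left side; the bracket moves through
   [phi], where it cancels [psi]. *)
move=> phi psi _ phiP phipsi psiphi f g.
rewrite -[LHS](comp_endo_cancel psiphi) -phiP.
by rewrite !(comp_endo_cancel phipsi).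
Qed.

Lemma tame_height_ge1 phi : tame phi -> forall i, height_ge 1 (tnth phi i).
Proof.
have X1 i : height_ge 1 ('X_i : {mpoly K[n + n]}) by apply: height_geX1.
elim=> {phi} [_ [A _|k f f0 _|k f f0 _]||phi psi _ phi1 _ psi1|] i.
- by rewrite tnth_linear; apply: height_ge_linform.
- rewrite tnth_mktuple; case: ifP => // _; apply: height_geD => //.
  apply: height_ge_comp => [|j]; first exact/height_ge1P.
  by rewrite tnth_mktuple.
- rewrite tnth_mktuple; case: ifP => // _; apply: height_geD => //.
  apply: height_ge_comp => [|j]; first exact/height_ge1P.
  by rewrite tnth_mktuple.
- by rewrite tnth_id.
- by rewrite tnth_comp; apply: height_ge_comp.
(* For an inverse, substituting the origin-preserving map into the j-th entry of [psi] keeps its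
   constant term and yields 'X_j. *)
move=> psi _ phi1 phipsi _ j; apply/height_ge1P.
have /height_ge1P := X1 j.
rewrite -(@tnth_id K n j) -phipsi tnth_comp mcoeff0_comp //.
Qed.

(** The shear fixes its own form l, as {l, l} = 0, so the opposite coefficient undoes it. *)
Lemma shear_inv b c e :
  endo_comp (shear b c e) (shear b (- c) e) = endo_id K n.
Proof.
apply: eq_from_tnth => i; rewrite tnth_comp tnth_id tnth_shear.
rewrite comp_mpolyD comp_mpolyXU -tnth_nth tnth_shear comp_mpolyZ.
rewrite rmorphM rmorphXn /= linform_shear poisson_self mul0r scaler0 addr0.
by rewrite poisson_linformX comp_mpolyC scaleNr addrK.
Qed.

Lemma shear_sympl b c e : symplectomorphism (shear b c e.+1).
Proof.
split; last exact: shear_preserves.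
exists (fun h => h \mPo shear b (- c) e.+1) => h;
  apply: comp_endo_cancel; last exact: shear_inv.
by rewrite -{2}[c]opprK shear_inv.
Qed.

(** For l = p_k the only nonzero bracket with a generator is {p_k, x_k} = 1. *)
Lemma elem_x_shear (k : 'I_n) c e :
  elem_x k (c *: 'X_k ^+ e) = shear (fun i => (i == pidx k)%:R : K) c e.
Proof.
apply: eq_from_tnth => i; rewrite tnth_shear tnth_mktuple linformX poissonXX.
have -> : (pidx k == dual i) = (i == xidx k).
  by rewrite -(inj_eq (can_inj (@dualK n))) dualK dual_pidx eq_sym.
case: eqP => [->|_]; last by rewrite mulr0 mul0r scaler0 addr0.
rewrite comp_mpolyZ rmorphXn /= comp_mpolyXU -tnth_nth tnth_mktuple.
by rewrite dsign_xidx !mulr1 mul1r.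
Qed.

Lemma tame_elem_shear (k : 'I_n) c e :
  tame (shear (fun i => (i == pidx k)%:R : K) c e.+1).
Proof.
rewrite -elem_x_shear; apply/tame_gen/TameElemX.
  rewrite mcoeffZ mpolyXn mcoeffX; case: eqP => [|_]; last by rewrite mulr0.
  by move=> /(congr1 (@mdeg n)); rewrite mdegMn mdeg1 mdeg0.
by rewrite elem_x_shear; apply: shear_sympl.
Qed.

(** With w = l - p_k, the transvection z |-> z - {w, z} w is a shear of exponent 1. The
    normalization of l at x_k gives {w, p_k} = -1, so that p_k goes to p_k + w = l. *)
Lemma transvection (k : 'I_n) b : b (xidx k) = 1 ->
  exists2 A, symplectic_mx A & tnth (linear_endo A) (pidx k) = linform b.
Proof.
move=> bx; pose w i := b i - (i == pidx k)%:R.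
pose A : 'M[K]_(n + n) :=
  \matrix_(i, j) ((i == j)%:R - (dsign K j * w (dual j)) * w i).
have AE : linear_endo A = shear w (-1) 1.
  apply: eq_from_tnth => j; rewrite tnth_linear tnth_shear poisson_linformX.
  rewrite -linformX mul_mpolyC scalerA mulN1r linformZ linformD.
  by apply: eq_linform => i; rewrite mxE mulNr.
exists A; first by apply/symplectic_mxP; rewrite AE; apply: shear_preserves.
rewrite tnth_linear; apply: eq_linform => i; rewrite mxE dsign_pidx dual_pidx.
rewrite /w bx /xidx /pidx eq_lrshift subr0 mulr1 mulN1r opprK.
by rewrite addrC subrK.
Qed.

(* The transvection T maps p_k to l = linform b, so that it conjugates the
   elementary shear along p_k into the shear along l. *)
Lemma tame_shear (k : 'I_n) b c e :
  b (xidx k) = 1 -> tame (shear b c e.+1).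
Proof.
move=> /transvection[A AJ Ap]; have [B AB BA] := linear_endo_inv AJ.
have tT : tame (linear_endo A) by apply/tame_gen/TameLinear.
have tT' : tame (linear_endo B) by apply: tame_inv tT AB BA.
have := tame_comp tT (tame_comp (tame_elem_shear k c e) tT').
congr tame; apply: eq_from_tnth => j.
have BT : linform (B^~ j) \mPo linear_endo A = 'X_j.
  by rewrite -tnth_linear -tnth_comp AB tnth_id.
rewrite tnth_comp tnth_comp tnth_linear linform_shear tnth_shear.
rewrite comp_mpolyD BT comp_mpolyZ rmorphM rmorphXn /=.
have pT : linform (fun i => (i == pidx k)%:R) \mPo linear_endo A = linform b.
  by rewrite linformX comp_mpolyXU -tnth_nth Ap.
(* The transvection preserves brackets, so it carries {p_k, -} to {l, -}. *)
by rewrite -(tame_preserves tT) BT pT.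
Qed.

End Tame.

(** * Monomials as combinations of powers of linear forms *)

Section PowersSpan.
Variable K : fieldType.
Hypothesis charK0 : [pchar K] =i pred0.

Lemma natr_neq0 k : (0 < k)%N -> k%:R != 0 :> K.
Proof. by move/pcharf0P: charK0 => -> ; rewrite lt0n. Qed.

Section Span.
Variables (V : lmodType K) (P : V -> Prop).
Hypothesis P0 : P 0.
Hypothesis PD : forall u v, P u -> P v -> P (u + v).
Hypothesis PZ : forall c u, P u -> P (c *: u).

(** Evaluating at t = 0, ..., N - 1, distinct in characteristic zero, gives an invertible
    Vandermonde system for the coefficients. *)
Lemma span_coef N (v : 'I_N -> V) :
  (forall t : K, P (\sum_(k < N) t ^+ k *: v k)) -> forall k, P (v k).
Proof.
move=> Pv k; pose a : 'rV[K]_N := \row_j j%:R; pose M := Vandermonde N a.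
have Mu : M \in unitmx.
  rewrite unitmxE det_Vandermonde unitfE; apply/prodf_neq0 => i _.
  apply/prodf_neq0 => j ij; rewrite !mxE -natrB ?natr_neq0 ?subn_gt0 //.
  exact: ltnW.
have -> : v k =
    \sum_(j < N) invmx M j k *: (\sum_(i < N) (j%:R : K) ^+ i *: v i).
  transitivity (\sum_i (M *m invmx M) i k *: v i).
    rewrite mulmxV // (bigD1 k) //= mxE eqxx scale1r big1 ?addr0 // => i.
    by move=> /negPf ik; rewrite mxE ik scale0r.
  under eq_bigr do rewrite mxE scaler_suml.
  rewrite exchange_big; apply: eq_bigr => j _; rewrite scaler_sumr.
  by apply: eq_bigr => i _; rewrite !mxE scalerA mulrC.
by apply: (big_ind P P0 PD) => j _; apply: PZ.
Qed.
End Span.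

Variables (m : nat) (W : {mpoly K[m]} -> Prop).
Hypothesis W0 : W 0.
Hypothesis WD : forall u v, W u -> W v -> W (u + v).
Hypothesis WZ : forall c u, W u -> W (c *: u).

(* The coefficients of t^k in q (Z + t X_i)^r are separated one variable
   at a time. *)
Lemma span_powers (s : seq 'I_m) (q Y : {mpoly K[m]}) r :
    uniq s ->
    (forall t : 'I_m -> K, W (q * (Y + \sum_(i <- s) t i *: 'X_i) ^+ r)) ->
  forall (e : 'I_m -> nat) r', (\sum_(i <- s) e i + r')%N = r ->
    W (q * \prod_(i <- s) 'X_i ^+ e i * Y ^+ r').
Proof.
elim: s q r => [|i s IHs] q r /=.
  move=> _ Wq e r'; rewrite !big_nil mulr1 add0n => ->.
  by have := Wq (fun=> 0); rewrite big_nil addr0.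
move=> /andP[is_ s_uniq] Wq e r'; rewrite !big_cons mulrA -addnA => er.
(* The factor 'X_i ^+ e i joins the prefix [q], leaving the exponent r - e i for the other
   variables. *)
apply: (IHs _ (r - e i)%N) => //; last by rewrite -er addKn.
move=> t; set Z := Y + _.
have lt_er : (e i < r.+1)%N by rewrite ltnS -er leq_addr.
pose v (k : 'I_r.+1) := ('C(r, k))%:R *: (q * 'X_i ^+ k * Z ^+ (r - k)).
have Wv : W (v (Ordinal lt_er)).
  apply: span_coef => // c.
  (* Only the parameter of 'X_i varies; as [s] has no repetition, the rest of the sum does not see
     c. *)
  have := Wq (fun j => if j == i then c else t j).
  rewrite big_cons eqxx; congr W.
  have -> : \sum_(j <- s) (if j == i then c else t j) *: 'X_j =
            \sum_(j <- s) t j *: 'X_j :> {mpoly K[m]}.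
    rewrite !big_seq; apply: eq_bigr => j js; case: eqP => // ji.
    by rewrite -ji js in is_.
  rewrite addrCA addrC -/Z exprDn mulr_sumr; apply: eq_bigr => k _.
  rewrite /v exprZn -scaler_nat -!scalerAr !scalerA mulrC; congr (_ *: _).
  by ring.
have /(@WZ ('C(r, e i)%:R^-1)) := Wv; rewrite /v scalerA mulVf ?scale1r //.
by rewrite natr_neq0 // bin_gt0.
Qed.

End PowersSpan.

(** * Euler's identity and the height filtration *)

Section Euler.
Variables (K : fieldType) (m : nat).

Lemma height_ge_mpolyX (k : 'X_{1..m}) N :
  (N <= mdeg k)%N -> height_ge N ('X_[k] : {mpoly K[m]}).
Proof.
move=> Nk l lN; rewrite mcoeffX; case: eqP => // kl.
by move: lN; rewrite -kl ltnNge Nk.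
Qed.

Lemma euler_mpolyX (k : 'X_{1..m}) :
  \sum_i 'X_i * ('X_[k])^`M(i) = (mdeg k)%:R *: 'X_[k] :> {mpoly K[m]}.
Proof.
rewrite mdegE natr_sum scaler_suml; apply: eq_bigr => i _.
rewrite mderivX -scalerAr.
(* If k i = 0 the truncated exponent k - U_(i) is harmless, its coefficient being zero. *)
have [->|ki] := posnP (k i); first by rewrite !scale0r.
rewrite -mpolyXD addmC submK //; apply/mnm_lepP => j; rewrite mnm1E.
by case: eqP => [<-|].
Qed.

(** The Euler operator multiplies the part of degree d by d, so subtracting N f kills the part of
    degree N. *)
Lemma euler_height N (f : {mpoly K[m]}) : height_ge N f ->
  height_ge N.+1 (\sum_i 'X_i * f^`M(i) - N%:R *: f).
Proof.
move=> fN.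
have -> : \sum_i 'X_i * f^`M(i) - N%:R *: f =
  \sum_(k <- msupp f) f@_k *: (((mdeg k)%:R - N%:R) *: 'X_[k]).
  rewrite {1 2}(mpolyE f) scaler_sumr.
  under eq_bigr do rewrite raddf_sum mulr_sumr.
  rewrite exchange_big -sumrB; apply: eq_bigr => k _ /=.
  rewrite scalerBl scalerBr -euler_mpolyX scaler_sumr scalerA mulrC -scalerA.
  congr (_ - _); apply: eq_bigr => i _.
  by rewrite mderivZ scalerAr.
rewrite big_seq; apply: height_ge_sum => k kf.
have [kN|kN|->] := ltngtP (mdeg k) N; last first.
- by rewrite subrr scale0r scaler0; apply: height_ge0.
- by do 2! apply: height_geZ; apply: height_ge_mpolyX.
by move: kf; rewrite mcoeff_msupp fN ?eqxx.
Qed.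

End Euler.

(** * Approximation by tame maps, one order at a time *)

Section Approximation.
Variables (K : fieldType) (n : nat).
Hypothesis charK0 : [pchar K] =i pred0.
Hypothesis n_ge1 : (1 <= n)%N.
Implicit Types (i j a b : 'I_(n + n)) (phi psi sigma : endo K n).
Implicit Types (H : {mpoly K[n + n]}).

Lemma endo_compA phi psi sigma :
  endo_comp phi (endo_comp psi sigma) = endo_comp (endo_comp phi psi) sigma.
Proof. by apply: eq_from_tnth => i; rewrite !tnth_comp endo_compE. Qed.

Lemma endo_comp_idl phi : endo_comp (endo_id K n) phi = phi.
Proof. by apply: eq_from_tnth => i; rewrite !tnth_comp comp_endo_id. Qed.

Lemma height_ge_poissonX N f i :
  height_ge N.+1 f -> height_ge N (poisson f 'X_i : {mpoly K[n + n]}).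
Proof.
by move=> fN; rewrite poissonX; apply: height_geZ; apply: height_ge_deriv.
Qed.

Lemma height_ge_poisson N M (f g : {mpoly K[n + n]}) :
  height_ge N.+1 f -> height_ge M.+1 g -> height_ge (N + M) (poisson f g).
Proof.
move=> fN gM; rewrite poissonE; apply: height_ge_sum => i _.
by apply/height_geZ/height_geM; apply: height_ge_deriv.
Qed.

(** The inverse is carried along as an explicit two-sided one, as [tame_inv] requires. *)
Definition tame_pair phi psi :=
  [/\ tame phi, endo_comp phi psi = endo_id K n
    & endo_comp psi phi = endo_id K n].

(** The Hamiltonians H whose flow, truncated after its first-order term, is matched by a tame map
    modulo height M + 1. *)
Definition tame_flow M H := height_ge M.+1 H /\
  exists phi psi, tame_pair phi psi /\
    forall i, height_ge M.+1 (tnth phi i - ('X_i + poisson H 'X_i)).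

Lemma tame_pair_comp phi1 psi1 phi2 psi2 :
  tame_pair phi1 psi1 -> tame_pair phi2 psi2 ->
  tame_pair (endo_comp phi1 phi2) (endo_comp psi2 psi1).
Proof.
move=> [t1 K1 K1'] [t2 K2 K2']; split; first exact: tame_comp.
  by rewrite -endo_compA (endo_compA phi2) K2 endo_comp_idl.
by rewrite -endo_compA (endo_compA psi1) K1' endo_comp_idl.
Qed.

Lemma tame_flow_high M H : height_ge M.+2 H -> tame_flow M H.
Proof.
move=> HM; split; first exact: height_geW HM.
exists (endo_id K n), (endo_id K n); split=> [|i].
  by split; rewrite ?endo_comp_idl //; apply: tame_id.
rewrite tnth_id opprD addNKr.
exact/height_geN/height_ge_poissonX.
Qed.

(** First-order flows compose additively: since M >= 2, [phi1] is the identity up to height 2, so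
    substituting it in {H2, z_i}, of height M, changes only terms of height M + 1. *)
Lemma tame_flowD M H1 H2 : (2 <= M)%N ->
  tame_flow M H1 -> tame_flow M H2 -> tame_flow M (H1 + H2).
Proof.
move=> M2 [H1M [phi1 [psi1 [t1 phi1E]]]] [H2M [phi2 [psi2 [t2 phi2E]]]].
split; first exact: height_geD.
exists (endo_comp phi1 phi2), (endo_comp psi2 psi1).
split=> [|i]; first exact: tame_pair_comp.
have [/tame_height_ge1 phi1_ge1 _ _] := t1.
set h := poisson H2 'X_i.
have hM : height_ge M h by apply: height_ge_poissonX.
have hphi : height_ge M.+1 ((h \mPo phi1) - h).
  rewrite -{2}(comp_endo_id h) -addn1 -{1}(muln1 M).
  apply: (proj1 (close_comp _ hM)) => j; rewrite tnth_id; split=> //.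
    exact: height_geX1.
  rewrite -[X in height_ge _ X](subrK (poisson H1 'X_j)) -[_ - _ - _]addrA.
  rewrite -opprD; apply: height_geD.
    by apply: height_geW (phi1E j); lia.
  by apply: height_geW M2 _; apply: height_ge_poissonX.
rewrite tnth_comp.
have -> : (tnth phi2 i \mPo phi1) - ('X_i + poisson (H1 + H2) 'X_i) =
    ((tnth phi2 i - ('X_i + h)) \mPo phi1)
    + (tnth phi1 i - ('X_i + poisson H1 'X_i)) + ((h \mPo phi1) - h).
  by rewrite comp_mpolyB comp_mpolyD comp_mpolyXU -tnth_nth poissonDl -/h; ring.
apply: height_geD hphi; apply: height_geD => //.
exact: height_ge_comp.
Qed.

Lemma tame_flow_power M (k : 'I_n) (l : 'I_(n + n) -> K) c :
  (2 <= M)%N -> l (xidx k) = 1 -> tame_flow M (c *: linform l ^+ M.+1).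
Proof.
case: M => // e _ lk; split.
  apply: height_geZ; elim: e.+2 => [|d IH]; first exact: height_ge_deg0.
  by rewrite exprS; apply: (@height_geM _ _ 1) => //; apply: height_ge_linform.
(* Here M = e + 1, and {c l^(e+2), z_i} = c (e+2) l^(e+1) {l, z_i}: the shear matches with no
   error. *)
exists (shear l (c * e.+2%:R) e.+1), (shear l (- (c * e.+2%:R)) e.+1).
split=> [|i].
  split; [exact: tame_shear lk | exact: shear_inv |].
  by rewrite -{2}[c * _]opprK shear_inv.
rewrite tnth_shear poissonZl poissonXnl scalerA [_ * poisson _ _]mulrC.
by rewrite subrr; apply: height_ge0.
Qed.

(** By additivity it suffices to treat monomials: those of degree above M + 1 are negligible, those
    of degree M + 1 come from powers of linear forms. *)
Lemma tame_flow_all M H : (2 <= M)%N -> height_ge M.+1 H -> tame_flow M H.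
Proof.
move=> M2 HM; have flow0 : tame_flow M 0 by apply/tame_flow_high/height_ge0.
have flowX k c : (M.+1 <= mdeg k)%N -> tame_flow M (c *: 'X_[k]).
  rewrite leq_eqVlt => /predU1P[Mk|Mk]; last first.
    by apply/tame_flow_high/height_geZ/height_ge_mpolyX.
  (* Quantifying over all scalars makes [W] closed under scaling by construction. *)
  pose W u := forall c, tame_flow M (c *: u).
  have W0 : W 0 by move=> c'; rewrite scaler0.
  have WD u v : W u -> W v -> W (u + v).
    by move=> Wu Wv c'; rewrite scalerDr; apply: tame_flowD.
  have WZ c' u : W u -> W (c' *: u) by move=> Wu c''; rewrite scalerA.
  suff: W 'X_[k] by [].
  (* The first x-variable keeps coefficient 1 in all the linear forms, as [tame_shear] demands. *)
  pose x0 := xidx (Ordinal n_ge1).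
  pose s := [seq i <- index_enum 'I_(n + n) | i != x0].
  have -> : 'X_[k] = 1 * \prod_(i <- s) 'X_i ^+ k i * 'X_x0 ^+ k x0
      :> {mpoly K[n + n]}.
    by rewrite mul1r big_filter mpolyXE_id (bigD1 x0) //= mulrC.
  apply: (@span_powers K charK0 _ W W0 WD WZ s 1 'X_x0 M.+1).
  - by apply: filter_uniq; apply: index_enum_uniq.
  - move=> t; rewrite mul1r big_filter => c'.
    pose l i := if i == x0 then 1 else t i.
    have lx0 : l x0 = 1 by rewrite /l eqxx.
    have := tame_flow_power c' M2 lx0.
    congr (tame_flow _ (_ *: _ ^+ _)).
    rewrite /linform (bigD1 x0) //= lx0 scale1r; congr (_ + _).
    by apply: eq_bigr => i /negPf ix; rewrite /l ix.
  by rewrite Mk mdegE [RHS](bigD1 x0) //= big_filter addnC.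
rewrite (mpolyE H) big_seq; apply: (big_ind (tame_flow M)) => //.
  by move=> ? ?; apply: tame_flowD.
move=> k kH; apply: flowX; rewrite leqNgt; apply/negP => kM.
by move: kH; rewrite mcoeff_msupp HM ?eqxx.
Qed.


(* The Poincare lemma: preservation of the bracket makes the one-form
   theta closed up to order M, and H is its radial primitive. *)
Lemma hamiltonian_approx M sigma : (2 <= M)%N -> preserves_poisson sigma ->
    (forall i, height_ge M (tnth sigma i - 'X_i)) ->
  exists2 H, height_ge M.+1 H &
    forall i, height_ge M.+1 (tnth sigma i - ('X_i + poisson H 'X_i)).
Proof.
move=> M2 sigmaP sigmaM; pose F i : {mpoly K[n + n]} := tnth sigma i - 'X_i.
(* Solving {H, z_i} = F_i for the partial derivatives of H gives dH/dz_a = theta a. *)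
pose theta a : {mpoly K[n + n]} := dsign K (dual a) *: F (dual a).
have thetaM a : height_ge M (theta a) by apply/height_geZ/sigmaM.
(* The factor 1/(M+1) is the integral of t^M over [0, 1], from integrating the part of degree M
   along rays. *)
pose H : {mpoly K[n + n]} := (M.+1%:R : K)^-1 *: \sum_a 'X_a * theta a.
have closed a b : height_ge M ((theta a)^`M(b) - (theta b)^`M(a)).
  have FF : height_ge M (poisson (F (dual a)) (F (dual b))).
    (* The quadratic term has height 2 (M - 1), which is at least M because M >= 2. *)
    apply: (@height_geW _ _ (M.-1 + M.-1)); first by lia.
    by apply: height_ge_poisson; rewrite prednK ?(ltnW M2) //; apply: sigmaM.
  have eqF : poisson (F (dual a)) 'X_(dual b) - poisson (F (dual b)) 'X_(dual a)
             = - poisson (F (dual a)) (F (dual b)).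
    have := preserves_poisson_tnth (dual a) (dual b) sigmaP.
    rewrite -poissonXX -[tnth _ (dual a)](subrK 'X_(dual a)) -/(F _).
    rewrite -[tnth _ (dual b)](subrK 'X_(dual b)) -/(F _).
    move: (F (dual a)) (F (dual b)) => fa fb.
    rewrite poissonDl !poissonDr [poisson 'X_(dual a) fb]poissonN.
    move=> /eqP; rewrite -subr_eq0 => E; apply/eqP; rewrite -subr_eq0.
    by apply: etrans E; congr (_ == 0); ring.
  have -> : (theta a)^`M(b) - (theta b)^`M(a) =
      (dsign K (dual a) * dsign K (dual b)) *:
      - poisson (F (dual a)) (F (dual b)).
    rewrite -eqF !poissonX !dualK !mderivZ scalerBr !scalerA.
    by rewrite -mulrA dsignK mulr1 mulrAC dsignK mul1r.
  exact/height_geZ/height_geN.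
have HE b : H^`M(b) = (M.+1%:R : K)^-1 *:
    (theta b + \sum_a 'X_a * (theta a)^`M(b)).
  rewrite mderivZ; congr (_ *: _); rewrite raddf_sum /=.
  under eq_bigr do rewrite mderivM mderivXU.
  rewrite big_split (bigD1 b) //= eqxx mul1r big1 ?addr0 // => a /negPf ab.
  by rewrite ab mul0r.
have dH b : height_ge M.+1 (H^`M(b) - theta b).
  (* Closedness trades the derivatives of theta a along b for those of theta b along a; Euler then
     gives M theta b, and with the undifferentiated term (M + 1) theta b. *)
  have -> : H^`M(b) - theta b = (M.+1%:R : K)^-1 *:
      (\sum_a 'X_a * ((theta a)^`M(b) - (theta b)^`M(a)) +
       (\sum_a 'X_a * (theta b)^`M(a) - M%:R *: theta b)).
    have -> : \sum_a 'X_a * ((theta a)^`M(b) - (theta b)^`M(a)) =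
        \sum_a 'X_a * (theta a)^`M(b) - \sum_a 'X_a * (theta b)^`M(a).
      by rewrite -sumrB; apply: eq_bigr => a _; rewrite mulrBr.
    rewrite addrA subrK HE.
    have thetaE : theta b = (M.+1%:R : K)^-1 *: (M.+1%:R *: theta b).
      by rewrite scalerA mulVf ?scale1r // natr_neq0.
    rewrite [X in _ - X]thetaE -scalerBr; congr (_ *: _).
    by rewrite -addn1 natrD scalerDl scale1r; ring.
  apply/height_geZ/height_geD; last exact: euler_height.
  apply: height_ge_sum => a _.
  by apply: (@height_geM _ _ 1) => //; apply: height_geX1.
exists H.
  apply/height_geZ/height_ge_sum => a _.
  by apply: (@height_geM _ _ 1) => //; apply: height_geX1.
move=> i; have -> : tnth sigma i - ('X_i + poisson H 'X_i) =
    - (dsign K i *: (H^`M(dual i) - theta (dual i))).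
  rewrite scalerBr -poissonX /theta dualK scalerA dsignK scale1r /F.
  by ring.
exact/height_geN/height_geZ.
Qed.

Lemma tame_approx_step M sigma : (2 <= M)%N -> preserves_poisson sigma ->
    (forall i, height_ge M (tnth sigma i - 'X_i)) ->
  exists phi psi, tame_pair phi psi /\
    forall i, height_ge M.+1 (tnth phi i - tnth sigma i).
Proof.
move=> M2 sigmaP /hamiltonian_approx[//|//|H /tame_flow_all[//|_ flowH] sigmaH].
have [phi [psi [t phiH]]] := flowH; exists phi, psi; split=> // i.
have -> : tnth phi i - tnth sigma i = (tnth phi i - ('X_i + poisson H 'X_i)) -
  (tnth sigma i - ('X_i + poisson H 'X_i)) by ring.
exact: height_geB.
Qed.

(** Substituting the origin-preserving [phi] does not lower heights, and it cancels [psi]. *)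
Lemma tame_approx_pull N sigma phi psi tau : tame_pair phi psi ->
    (forall i, height_ge N (tnth tau i - tnth (endo_comp psi sigma) i)) ->
    forall i, height_ge N (tnth (endo_comp phi tau) i - tnth sigma i).
Proof.
move=> [/tame_height_ge1 phi1 phiK _] tauN i.
rewrite -(comp_endo_cancel phiK (tnth sigma i)) -tnth_comp tnth_comp.
by rewrite -comp_mpolyB; apply: height_ge_comp.
Qed.

Lemma tame_approx_push N sigma phi psi : tame_pair phi psi ->
    (forall i, height_ge N (tnth phi i - tnth sigma i)) ->
    forall i, height_ge N (tnth (endo_comp psi sigma) i - 'X_i).
Proof.
move=> [tphi phiK psiK] sigmaN i.
have /tame_height_ge1 psi1 := tame_inv tphi phiK psiK.
rewrite -(tnth_id K) -psiK !tnth_comp -comp_mpolyB -opprB comp_mpolyN.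
by apply/height_geN/height_ge_comp.
Qed.

Lemma tame_pair_preserves phi psi : tame_pair phi psi -> preserves_poisson psi.
Proof. by move=> [tphi phiK psiK]; apply/tame_preserves/(tame_inv tphi). Qed.

(** Induction on the number N of orders to gain: the step gives [phi] matching [sigma] up to height
    M + 1, and the induction hypothesis applies to [sigma] composed with its inverse, with M + 1 for
    M. *)
Lemma tame_approx_unipotent N M sigma : (2 <= M)%N -> preserves_poisson sigma ->
    (forall i, height_ge M (tnth sigma i - 'X_i)) ->
  exists2 tau, tame tau &
    forall i, height_ge (N + M) (tnth tau i - tnth sigma i).
Proof.
elim: N M sigma => [|N IHN] M sigma M2 sigmaP sigmaM.
  exists (endo_id K n) => [|i]; first exact: tame_id.
  by rewrite tnth_id -opprB; apply: height_geN.
have [phi [psi [t phiM]]] := tame_approx_step M2 sigmaP sigmaM.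
have [|||tau ttau tauN] := IHN M.+1 (endo_comp psi sigma).
- exact: ltnW.
- by apply: preserves_poisson_comp => //; apply: tame_pair_preserves t.
- exact: tame_approx_push t phiM.
exists (endo_comp phi tau) => [|i].
  by case: t => tphi _ _; apply: tame_comp.
by rewrite addSnnS; apply: tame_approx_pull t tauN i.
Qed.

(** Dropping terms of height 2 changes brackets only in height 1 and above; the brackets of the
    linear parts and those of [sigma] are constants, hence equal. *)
Lemma linear_part_symplectic sigma : preserves_poisson sigma ->
    (forall i, height_ge 1 (tnth sigma i)) ->
  exists2 A, symplectic_mx A &
    forall i, height_ge 2 (tnth (linear_endo A) i - tnth sigma i).
Proof.
move=> sigmaP sigma1.
pose A : 'M[K]_(n + n) := \matrix_(i, j) (tnth sigma j)@_U_(i).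
have A2 j : height_ge 2 (tnth (linear_endo A) j - tnth sigma j).
  move=> k; rewrite ltnS leq_eqVlt => /predU1P[/eqP/mdeg1P[i /eqP->]|k0].
    rewrite mcoeffB tnth_linear raddf_sum (bigD1 i) //= big1 => [|l /negPf li].
      by rewrite mcoeffZ mcoeffXU eqxx mulr1 addr0 mxE subrr.
    by rewrite mcoeffZ mcoeffXU li mulr0.
  rewrite mcoeffB sigma1 // subr0 tnth_linear.
  exact: (@height_ge_linform K n).
exists A => //; apply/matrixP => i j; apply: oppr_inj.
set f := tnth sigma i; set g := tnth sigma j.
set p := tnth (linear_endo A) i; set q := tnth (linear_endo A) j.
have : height_ge 1 (poisson p q - poisson f g).
  have -> : poisson p q - poisson f g = poisson (p - f) q + poisson f (q - g).
    rewrite poissonDl poissonDr -[- f]scaleN1r -[- g]scaleN1r.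
    by rewrite poissonZl poissonZr !scaleN1r addrA subrK.
  have q1 : height_ge 1 q by rewrite /q tnth_linear; apply: height_ge_linform.
  apply: height_geD; first by apply: (@height_ge_poisson 1 0) q1; apply: A2.
  by apply: (@height_ge_poisson 0 1); [apply: sigma1 | apply: A2].
rewrite /p /q poisson_linear preserves_poisson_tnth // => /height_ge1P/eqP.
rewrite -mpolyCB mcoeffC eqxx mulr1 subr_eq0 => /eqP->.
by rewrite -/(symp_form K n) symp_formE opprK.
Qed.

Lemma tame_approx N sigma : preserves_poisson sigma ->
    (forall i, height_ge 1 (tnth sigma i)) ->
  exists2 tau, tame tau & forall i, height_ge N (tnth tau i - tnth sigma i).
Proof.
move=> sigmaP /(linear_part_symplectic sigmaP)[A AJ A2].
have [B AB BA] := linear_endo_inv AJ.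
have tA : tame (linear_endo A) by apply/tame_gen/TameLinear.
have t : tame_pair (linear_endo A) (linear_endo B) by split.
have [||tau ttau tauN] :=
  @tame_approx_unipotent N 2 (endo_comp (linear_endo B) sigma) isT.
- by apply: preserves_poisson_comp => //; apply: tame_pair_preserves t.
- exact: tame_approx_push t A2.
exists (endo_comp (linear_endo A) tau) => [|i]; first exact: tame_comp.
by apply: height_geW (tame_approx_pull t tauN i); apply: leq_addr.
Qed.

End Approximation.

(** * From height bounds to convergence in the metric *)

Section Convergence.
Variables (K : fieldType) (n : nat).

(** [None] is the infinite height and meets every bound. *)
Definition at_least N (h : option nat) : bool :=
  if h is Some k then (N <= k)%N else true.

Lemma height_geP m N (f : {mpoly K[m]}) : height_ge N f ->
  at_least N (height f).
Proof.
move=> fN; rewrite /height; case: {-}_ / boolP => // f0.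
case: ex_minnP => k; rewrite /= leqNgt => fk _; apply/negP => kN.
case/eqP: fk; rewrite pihomogE big1_seq // => l /andP[/eqP lk _].
by rewrite fN ?scale0r // lk.
Qed.

Lemma tuple_height_geP N (phi : endo K n) :
    (forall i, height_ge N (tnth phi i)) ->
  at_least N (tuple_height phi).
Proof.
move=> phiN; rewrite /tuple_height.
apply: (big_ind (fun h => at_least N h : Prop)) =>
  // [[a|] [b|] //= aN bN|i _]; first by rewrite leq_min aN.
exact: height_geP.
Qed.

End Convergence.

(** Choose N > 0 with 1/N < eps; for k >= N one has N <= k < 1 + k < exp k. *)
Lemma exp_opp_INR_small (eps : Rdefinitions.R) :
  Rdefinitions.Rlt Rdefinitions.R0 eps ->
  exists N : nat, forall k : nat, (N <= k)%N ->
    Rdefinitions.Rlt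
      (Rtrigo_def.exp (Rdefinitions.Ropp (Raxioms.INR k))) eps.
Proof.
move=> eps0; have [N [Neps N0]] := Rtrigo_def.archimed_cor1 eps eps0.
exists N => k Nk; apply: Raxioms.Rlt_trans Neps.
rewrite Rpower.exp_Ropp; apply: RIneq.Rinv_lt_contravar.
  apply: RIneq.Rmult_lt_0_compat; first exact: RIneq.lt_0_INR.
  exact: Exp_prop.exp_pos.
apply: (RIneq.Rle_lt_trans _ _ _ (RIneq.le_INR _ _ (elimT leP Nk))).
have k0 : Raxioms.INR k <> Rdefinitions.R0 by apply: RIneq.not_0_INR; lia.
apply: Raxioms.Rlt_trans (Rpower.exp_ineq1 _ k0).
by rewrite Raxioms.Rplus_comm; apply: RIneq.Rlt_plus_1.
Qed.

Lemma endo_cvg_height (K : fieldType) n (tau : nat -> endo K n)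
    (sigma : endo K n) :
    (forall k i, height_ge k (tnth (tau k) i - tnth sigma i)) ->
  endo_cvg tau sigma.
Proof.
move=> tauE eps eps0; have [N Neps] := exp_opp_INR_small eps0.
exists N => k /leP Nk; rewrite /Rfunctions.Rdist RIneq.Rminus_0_r.
have : at_least k (tuple_height (endo_sub (tau k) sigma)).
  by apply: tuple_height_geP => i; rewrite tnth_mktuple.
rewrite /endo_dist; case: tuple_height => [h /= kh|_].
  rewrite Rbasic_fun.Rabs_pos_eq; first exact/Neps/(leq_trans Nk).
  exact/RIneq.Rlt_le/Exp_prop.exp_pos.
by rewrite Rbasic_fun.Rabs_R0.
Qed.

Theorem theorem2 (K : fieldType) (charK0 : [pchar K] =i pred0)
    (n : nat) (n_ge1 : (1 <= n)%N) (sigma : endo K n)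
    (sigma_sympl : symplectomorphism sigma)
    (sigma_jac : jacobian sigma = 1)
    (sigma_orig : origin_preserving sigma) :
  exists tau : nat -> endo K n,
    (forall k : nat, (1 <= k)%N -> tame (tau k)) /\ endo_cvg tau sigma.
Proof.
have sigma1 i : height_ge 1 (tnth sigma i) by apply/height_ge1P.
have approx k : exists tau, tame tau /\
    forall i, height_ge k (tnth tau i - tnth sigma i).
  have [tau ? ?] := tame_approx charK0 n_ge1 k sigma_sympl.2 sigma1.
  by exists tau.
(* Choice picks for each k a tame map agreeing with [sigma] up to height k, thus at distance at most
   exp(-k). *)
have [tau tauP] := IndefiniteDescription.functional_choice _ approx.
exists tau; split=> [k _|]; first by have [] := tauP k.
by apply: endo_cvg_height => k; have [] := tauP k.
Qed.
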